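(* Suppose $\{P_n\}_{n=1}^\infty \subset \mathcal P(\mathbb S^{d-1})$ is a sequence of measures such that $P_n \xrightarrow{w} P$ as $n \to \infty$, where $P \in \mathcal P(\mathbb S^{d-1})$ satisfies $P(\partial H) = 0$ for all $H \in \mathcal H_0$. Then $$\sup_{x \in \mathbb S^{d-1}} \left| \mathrm{ahD}(x;P_n) - \mathrm{ahD}(x;P) \right| \xrightarrow[n\to\infty]{} 0.$$
   Context: Let $d \ge 2$ be an integer, $\mathbb S^{d-1} = \{x \in \mathbb R^d : \|x\| = 1\}$, and let $\mathcal P(\mathbb S^{d-1})$ be the set of Borel probability measures on $\mathbb S^{d-1}$; $P_n \xrightarrow{w} P$ denotes weak convergence of measures. For a Borel set $A \subseteq \mathbb R^d$ and $P \in \mathcal P(\mathbb S^{d-1})$, write $P(A) = P(A \cap \mathbb S^{d-1})$. For $u \in \mathbb S^{d-1}$ let $H_{0,u} = \{y \in \mathbb R^d : \langle y,u\rangle \ge 0\}$ and $\mathcal H_0 = \{H_{0,u} : u \in \mathbb S^{d-1}\}$; $\partial H$ is the topological boundary of $H$. The angular halfspace depth is $$\mathrm{ahD}(x;P) = \inf\{P(H_{0,u}) : u \in \mathbb S^{d-1},\ x \in H_{0,u}\},\qquad x \in \mathbb S^{d-1}.$$ *)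

(* Defs.v *)
From HB Require Import structures.
From mathcomp Require Import all_boot all_order all_algebra.
From mathcomp Require Import all_classical all_reals all_analysis.

Set Implicit Arguments.
Unset Strict Implicit.
Unset Printing Implicit Defensive.

Import Order.TTheory GRing.Theory Num.Theory.
Import numFieldNormedType.Exports.

Local Open Scope classical_set_scope.
Local Open Scope ring_scope.

Definition boundary (T : topologicalType) (A : set T) : set T :=
  closure A `\` A°.

Notation borel T := (g_sigma_algebraType (@open T)).

Definition weak_cvg (R : realType) (T : ptopologicalType)
    (P_ : nat -> probability (borel T) R) (P : probability (borel T) R) : Prop :=
  forall f : T -> R, continuous f -> bounded_fun f ->
    (\int[P_ n]_x (f x)%:E)%E @[n --> \oo] --> (\int[P]_x (f x)%:E)%E.

(* The library norm `|x| on 'rV[R]_d is the sup norm, hence the explicit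
   Euclidean structure. The two norms induce the same topology, so the library
   topology on 'rV[R]_d is the usual one. *)
Definition dot (R : realType) (d : nat) (x y : 'rV[R]_d) : R :=
  \sum_(i < d) x ord0 i * y ord0 i.

Definition enorm (R : realType) (d : nat) (x : 'rV[R]_d) : R :=
  Num.sqrt (dot x x).

Definition unit_sphere (R : realType) (d : nat) : set 'rV[R]_d :=
  [set x | enorm x = 1].
Arguments unit_sphere : clear implicits.

Lemma unit_sphere_delta (R : realType) (d : nat) (i : 'I_d) :
  delta_mx ord0 i \in unit_sphere R d.
Proof.
apply/mem_set; rewrite /unit_sphere /= /enorm /dot (bigD1 i) //= mxE !eqxx mulr1.
rewrite big1 ?addr0 ?sqrtr1 // => j ji.
by rewrite mxE (negbTE ji) andbF mulr0.
Qed.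

(* The unit sphere as a type of its own, with the subspace topology. The proof
   of [1 < d] is an argument because a [measurableType] must be pointed. *)
Definition sphere (R : realType) (d : nat) (hd : (1 < d)%N) : Type :=
  set_type (unit_sphere R d).
Arguments sphere R {d} hd.

HB.instance Definition _ (R : realType) (d : nat) (hd : (1 < d)%N) :=
  PseudoMetric.copy (sphere R hd) (set_type (unit_sphere R d)).
HB.instance Definition _ (R : realType) (d : nat) (hd : (1 < d)%N) :=
  isPointed.Build (sphere R hd)
    (exist (fun x => x \in unit_sphere R d) _
      (unit_sphere_delta R (Ordinal (ltnW hd)))).

Definition point_of (R : realType) (d : nat) (hd : (1 < d)%N)
  (x : sphere R hd) : 'rV[R]_d := sval x.
Coercion point_of : sphere >-> matrix.

Definition halfspace0 (R : realType) (d : nat) (u : 'rV[R]_d) : set 'rV[R]_d :=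
  [set y | 0 <= dot y u].

Section sphere_measures.
Context (R : realType) (d : nat) (hd : (1 < d)%N).

Definition central_halfspaces : set (set 'rV[R]_d) :=
  [set halfspace0 u | u in [set: sphere R hd]].

(* [P A] for a subset [A] of R^d stands for the mass of the trace of [A] on the
   sphere. *)
Definition mass (P : probability (borel (sphere R hd)) R) (A : set 'rV[R]_d) :
  \bar R := P [set x : sphere R hd | A x].

Definition ahD (x : sphere R hd) (P : probability (borel (sphere R hd)) R) :
    \bar R :=
  ereal_inf [set mass P (halfspace0 u) | u in
    [set u : sphere R hd | halfspace0 u x]].

End sphere_measures.
Arguments central_halfspaces R {d} hd.

(* Main.v *)
Require Import Defs.
From HB Require Import structures.
From mathcomp Require Import all_boot all_order all_algebra.
From mathcomp Require Import all_classical all_reals all_analysis.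
From mathcomp Require Import lra measurable_realfun.

Set Implicit Arguments.
Unset Strict Implicit.
Unset Printing Implicit Defensive.

Import Order.TTheory GRing.Theory Num.Theory.
Import numFieldNormedType.Exports.

Local Open Scope classical_set_scope.
Local Open Scope ring_scope.

(** The depth of [x] under two measures is an infimum over the same family of
    halfspaces, so it is enough that the masses of all central halfspaces
    converge uniformly in the direction ([mass_halfspace0_uniform]); the infima
    are then uniformly close as well ([le_ahD]).

    Uniformity comes from the compactness of the sphere of directions, and so
    reduces to a local statement ([mass_halfspace0_near]): near a direction [u]
    and for large [n], the masses of the halfspace of normal [v] under [P_ n]
    and [P] are close. Its proof is a sandwich. The great sphere orthogonal to
    [u] is the trace of the boundary of the halfspace of [u], hence is [P]-null,
    so by continuity from above some strip of points [y] with
    [|<y, u>| <= c] has small [P]-mass ([strip_small]). For [v] near [u] the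
    functions [<., u>] and [<., v>] differ by at most [c / 2] on the sphere, so
    the halfspace of [v] is trapped between the superlevel sets of [<., u>] at
    the levels [c] and [- c], with room [c / 2] to spare on either side. This
    room lets a continuous ramp separate the levels, and weak convergence tested
    on the ramp compares superlevel sets of slightly different levels
    ([weak_cvg_superlevel]). What is lost between the levels [- c] and [c] is the
    mass of the strip. *)

(** * Borel sets and continuous functions *)

Lemma open_borel (T : ptopologicalType) (A : set T) :
  open A -> measurable (A : set (borel T)).
Proof. by move=> oA; exact: sub_sigma_algebra. Qed.

Lemma closed_borel (T : ptopologicalType) (A : set T) :
  closed A -> measurable (A : set (borel T)).
Proof.
move=> cA; rewrite -[A]setCK; apply: (@measurableC _ (borel T)).
by apply: open_borel; exact: closed_openC.
Qed.

Lemma continuous_borel (R : realType) (T : ptopologicalType) (f : T -> R) :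
  continuous f -> measurable_fun setT (f : borel T -> R).
Proof.
move=> /continuousP cf; apply: (measurability _ (RGenOpens.measurableE R)).
move=> _ [_ [a [b ->] <-]]; rewrite setTI; apply: open_borel.
by apply: cf; exact: interval_open.
Qed.

Definition superlevel (R : realType) (T : Type) (g : T -> R) (a : R) : set T :=
  [set x | a <= g x].

Lemma superlevel_closed (R : realType) (T : topologicalType) (g : T -> R)
    (a : R) :
  continuous g -> closed (superlevel g a).
Proof.
move=> cg.
by apply: (preimage_closed (D := [set y | a <= y])) => //; exact: closed_ge.
Qed.

Lemma strip_closed (R : realType) (T : topologicalType) (g : T -> R) (c : R) :
  continuous g -> closed [set x | `|g x| <= c].
Proof.
move=> cg.
apply: (preimage_closed (D := [set r : R | r <= c]) (f := fun x => `|g x|)).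
  move=> x _; apply: (@continuous_comp _ _ _ g (fun r : R => `|r|)).
    exact: cg.
  exact: norm_continuous.
exact: closed_le.
Qed.

(** The strips decrease to the null set of zeros of [g]. *)
Lemma strip_small (R : realType) (T : ptopologicalType)
    (P : probability (borel T) R) (g : T -> R) (e : R) :
  continuous g -> P [set x | g x = 0] = 0%E -> 0 < e ->
  exists2 c, 0 < c & (P [set x | (`|g x| <= c)%R] <= e%:E)%E.
Proof.
move=> cg P0 e0.
pose F k := [set x | `|g x| <= k.+1%:R^-1].
have capF : \bigcap_k F k = [set x | g x = 0].
  apply/seteqP; split => x /=; last first.
    by move=> x0 k _; rewrite /F /= x0 normr0 invr_ge0 ler0n.
  move=> xF; apply/eqP/negPn/negP => x0.
  have gx0 : 0 < `|g x| by rewrite normr_gt0.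
  have [k /= kx] := filter_ex (cvgr_lt _ (@cvg_harmonic R) _ gx0).
  by have := xF k I; rewrite /F /= leNgt kx.
have mF k : measurable (F k : set (borel T)).
  by apply: closed_borel; exact: strip_closed.
have : P (F k) @[k --> \oo] --> P (\bigcap_n F n).
  apply: nonincreasing_cvg_mu => //.
  - by rewrite (le_lt_trans (probability_le1 _ _))// ltry.
  - by apply: bigcapT_measurable.
  - move=> m n mn; apply/subsetPset => x; rewrite /F /= => /le_trans; apply.
    by rewrite lef_pV2 ?posrE// ler_nat ltnS.
rewrite capF P0 => /fine_cvgP[finF /cvgr_le/(_ _ e0) leF].
have [k [/= Fk ke]] := filter_ex (filterI finF leF).
exists k.+1%:R^-1; first by rewrite invr_gt0.
by rewrite -[leLHS](fineK Fk) lee_fin.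
Qed.

(** * Weak convergence and superlevel sets *)

Section ramp.
Context (R : realType) (T : ptopologicalType) (g : T -> R) (a b : R).
Hypotheses (cg : continuous g) (ab : a < b).

Definition ramp (x : T) : R := Num.min 1 (Num.max 0 ((g x - a) / (b - a))).

Lemma ramp_ge0 x : 0 <= ramp x.
Proof. by rewrite /ramp le_min ler01 le_max lexx. Qed.

Lemma ramp_le1 x : ramp x <= 1.
Proof. by rewrite /ramp ge_min lexx. Qed.

Lemma ramp_hi x : b <= g x -> ramp x = 1.
Proof.
move=> bx; apply/le_anti; rewrite ramp_le1 /ramp le_min lexx le_max.
by rewrite ler_pdivlMr ?subr_gt0// mul1r lerB// orbT.
Qed.

Lemma ramp_lo x : g x <= a -> ramp x = 0.
Proof.
move=> xa; apply/le_anti; rewrite ramp_ge0 andbT /ramp ge_min ge_max lexx.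
by rewrite pmulr_lle0 ?invr_gt0 ?subr_gt0// subr_le0 xa orbT.
Qed.

Lemma ramp_continuous : continuous ramp.
Proof.
move=> x; apply: (@continuous_min R T (cst 1)); first exact: cvg_cst.
apply: (@continuous_max R T (cst 0)); first exact: cvg_cst.
by apply: cvgMl; apply: cvgB; [exact: cg|exact: cvg_cst].
Qed.

Lemma ramp_bounded : bounded_fun ramp.
Proof.
exists 1; split=> // M M1 x _ /=.
by rewrite ger0_norm ?ramp_ge0// (le_trans (ramp_le1 x))// ltW.
Qed.

(** The ramp lies between the indicators of the two superlevel sets. *)
Lemma integral_ramp (Q : probability (borel T) R) :
  (Q (superlevel g b) <= \int[Q]_x (ramp x)%:E <= Q (superlevel g a))%E.
Proof.
have mS c : measurable (superlevel g c : set (borel T)).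
  by apply: closed_borel; exact: superlevel_closed.
have mr : measurable_fun [set: borel T] (fun x => (ramp x)%:E).
  by apply/measurable_EFinP; apply: continuous_borel; exact: ramp_continuous.
have mi c :
    measurable_fun [set: borel T] (fun x => (\1_(superlevel g c) x : R)%:E).
  by apply/measurable_EFinP; exact: measurable_indic.
have iE c : Q (superlevel g c) = (\int[Q]_x (\1_(superlevel g c) x)%:E)%E.
  by rewrite integral_indic// setIT.
rewrite !iE; apply/andP; split; apply: ge0_le_integral => //= x _;
  rewrite lee_fin ?ramp_ge0//.
- rewrite indicE; case: (boolP (x \in _)) => [/set_mem/ramp_hi ->//|_].
  exact: ramp_ge0.
- rewrite indicE; case: (boolP (x \in _)) => [_|/negP nx]; first exact: ramp_le1.
  rewrite ramp_lo// leNgt; apply/negP => ax.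
  by apply: nx; apply/mem_set; exact: ltW.
Qed.

End ramp.

(** A quantitative form of the portmanteau theorem: the gap between [a]
    and [b] leaves room for a continuous test function. *)
Lemma weak_cvg_superlevel (R : realType) (T : ptopologicalType)
    (P_ : nat -> probability (borel T) R) (P : probability (borel T) R)
    (g : T -> R) (a b e : R) :
  weak_cvg P_ P -> continuous g -> a < b -> 0 < e ->
  \forall n \near \oo,
    (P_ n (superlevel g b) <= P (superlevel g a) + e%:E)%E /\
    (P (superlevel g b) <= P_ n (superlevel g a) + e%:E)%E.
Proof.
move=> wP cg ab e0.
have mS c : measurable (superlevel g c : set (borel T)).
  by apply: closed_borel; exact: superlevel_closed.
have fI (Q : probability (borel T) R) :
    (\int[Q]_x (ramp g a b x)%:E)%E \is a fin_num.
  have /andP[_ h] := integral_ramp cg ab Q.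
  rewrite ge0_fin_numE; last first.
    by apply: integral_ge0 => x _; rewrite lee_fin ramp_ge0.
  by rewrite (le_lt_trans h)// (le_lt_trans (probability_le1 _ _))// ltry.
have := wP _ (@ramp_continuous _ _ g a b cg) (@ramp_bounded _ _ g a b).
rewrite -(fineK (fI P)) => /fine_cvgP[_ /cvgrPdist_le/(_ _ e0)].
apply: filterS => n /=; rewrite ler_distl => /andP[h1 h2].
have {}h1 : (\int[P_ n]_x (ramp g a b x)%:E <=
             \int[P]_x (ramp g a b x)%:E + e%:E)%E.
  by rewrite -(fineK (fI P)) -(fineK (fI (P_ n))) -EFinD lee_fin; lra.
have {}h2 : (\int[P]_x (ramp g a b x)%:E <=
             \int[P_ n]_x (ramp g a b x)%:E + e%:E)%E.
  by rewrite -(fineK (fI P)) -(fineK (fI (P_ n))) -EFinD lee_fin; lra.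
have /andP[n1 n2] := integral_ramp cg ab (P_ n).
have /andP[p1 p2] := integral_ramp cg ab P.
split.
- by apply: (le_trans n1); apply: (le_trans h1); rewrite leeD2r.
- by apply: (le_trans p1); apply: (le_trans h2); rewrite leeD2r.
Qed.

(** * Geometry of the sphere and of central halfspaces *)

Section geometry.
Context (R : realType) (d : nat).
Implicit Types u v y : 'rV[R]_d.

Lemma dot_linearl u y v (t : R) : dot (y + t *: v) u = dot y u + t * dot v u.
Proof.
rewrite /dot mulr_sumr -big_split /=; apply: eq_bigr => i _.
by rewrite !mxE mulrDl mulrA.
Qed.

Lemma dot_sphere u : unit_sphere R d u -> dot u u = 1.
Proof.
rewrite /unit_sphere /= /enorm => h.
rewrite -(@sqr_sqrtr _ (dot u u)) ?h ?expr1n//.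
by apply: sumr_ge0 => i _; rewrite -expr2 sqr_ge0.
Qed.

Lemma dot_continuous (T : topologicalType) (f g : T -> 'rV[R]_d) :
  continuous f -> continuous g -> continuous (fun x => dot (f x) (g x)).
Proof.
move=> cf cg; apply: continuous_big => [|i _ x]; first exact: add_continuous.
apply: cvgM.
  apply: (@continuous_comp _ _ _ f (fun y => y ord0 i)); first exact: cf.
  exact: coord_continuous.
apply: (@continuous_comp _ _ _ g (fun y => y ord0 i)); first exact: cg.
exact: coord_continuous.
Qed.

Lemma dot_continuousl u : continuous (fun y => dot y u).
Proof.
apply: (@dot_continuous _ id (cst u)) => x; first exact: cvg_id.
by apply: cst_continuous.
Qed.

Lemma dot_self_continuous : continuous (fun y => dot y y).
Proof. by apply: (@dot_continuous _ id id) => x; exact: cvg_id. Qed.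

Lemma sphere_coord_le1 y i : unit_sphere R d y -> `|y ord0 i| <= 1.
Proof.
move=> /dot_sphere y1; rewrite -(@expr_le1 _ 2)// real_normK ?num_real//.
rewrite -y1 /dot (bigD1 i)//= -expr2 lerDl.
by apply: sumr_ge0 => j _; rewrite -expr2 sqr_ge0.
Qed.

Lemma coord_le_norm y i : `|y ord0 i| <= `|y|.
Proof.
rewrite [leRHS]/Num.norm /= mx_normrE.
by apply/bigmax_geP; right => /=; exists (ord0, i).
Qed.

(** The norm on [u - v] is the sup norm, so Cauchy-Schwarz is replaced by the
    cruder bound [|<y, u - v>| <= d * |u - v|]. *)
Lemma dot_near u (e : R) : 0 < e ->
  \forall v \near u, forall y, unit_sphere R d y -> `|dot y u - dot y v| <= e.
Proof.
(* [d.+1] instead of [d] keeps the denominator nonzero for every [d]. *)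
move=> e0; have e0' : 0 < e / d.+1%:R by rewrite divr_gt0.
have /cvgrPdist_le/(_ _ e0') : id v @[v --> u] --> u by exact: cvg_id.
apply: filterS => v uv y Sy.
have -> : dot y u - dot y v = \sum_(i < d) y ord0 i * (u - v) ord0 i.
  by rewrite /dot -sumrB; apply: eq_bigr => i _; rewrite !mxE mulrBr.
apply: (le_trans (ler_norm_sum _ _ _)).
apply: (@le_trans _ _ (\sum_(i < d) e / d.+1%:R)).
  apply: ler_sum => i _; rewrite normrM -[leRHS]mul1r ler_pM//.
    exact: sphere_coord_le1.
  by apply: le_trans uv; exact: coord_le_norm.
rewrite sumr_const card_ord -[leLHS]mulr_natr mulrAC ler_pdivrMr// ler_pM2l//.
by rewrite ler_nat.
Qed.

Lemma unit_sphere_compact : compact (unit_sphere R d).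
Proof.
apply: bounded_closed_compact.
  exists 1; split=> // M M1 y Sy; apply: le_trans (ltW M1).
  rewrite [leLHS]/Num.norm /= mx_normrE; apply/bigmax_leP.
  by split=> // -[i j] _ /=; rewrite ord1; exact: sphere_coord_le1.
have -> : unit_sphere R d = (fun y => dot y y) @^-1` [set 1].
  apply/seteqP; split => y /=; first exact: dot_sphere.
  by rewrite /unit_sphere /= /enorm => ->; rewrite sqrtr1.
apply: preimage_closed; last exact: closed_eq.
by move=> y _; exact: dot_self_continuous.
Qed.

(** A point of the hyperplane leaves the halfspace when it is moved along
    [- u]. *)
Lemma boundary_halfspace0 u : unit_sphere R d u ->
  boundary (halfspace0 u) = [set y | dot y u = 0].
Proof.
move=> Su; apply/seteqP; split=> y /=.
- move=> [cy iy].
  have cH : closed (halfspace0 u).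
    apply: (superlevel_closed (g := fun z => dot z u)).
    exact: dot_continuousl.
  have : 0 <= dot y u by exact: cH.
  rewrite le_eqVlt => /orP[/eqP//|y0]; exfalso; apply: iy.
  exact: (cvgr_ge (dot y u) (@dot_continuousl u y) 0 y0).
- move=> y0; split; first by apply: subset_closure; rewrite /halfspace0 /= y0.
  move=> iy.
  have c0 : (y + t *: u) @[t --> (0 : R)^'-] --> y + 0 *: u.
    apply: cvg_at_left_filter; apply: cvgD; first exact: cvg_cst.
    by apply: cvgZr_tmp; exact: cvg_id.
  rewrite scale0r addr0 in c0.
  have nH : \forall t \near (0 : R)^'-, halfspace0 u (y + t *: u).
    by exact: c0 _ iy.
  have [t [/= + t0]] := filter_ex (filterI nH (nbhs_left_lt (0 : R))).
  by rewrite /halfspace0 /= dot_linearl y0 dot_sphere// add0r mulr1 leNgt t0.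
Qed.

End geometry.

(** * Uniform convergence of halfspace masses and depths *)

Section spherical_depth.
Context (R : realType) (d : nat) (hd : (1 < d)%N).
Implicit Types (P Q : probability (borel (sphere R hd)) R) (u v : 'rV[R]_d).

Lemma point_of_sphere (x : sphere R hd) : unit_sphere R d x.
Proof. by case: x => x /= /set_mem. Qed.

Lemma dot_sphere_continuous u : continuous (fun x : sphere R hd => dot x u).
Proof.
move=> x.
apply: (@continuous_comp _ _ _ (@point_of R d hd) (fun y => dot y u)).
  exact: initial_continuous.
exact: dot_continuousl.
Qed.

Lemma halfspace0_measurable v :
  measurable
    ([set x : sphere R hd | halfspace0 v x] : set (borel (sphere R hd))).
Proof.
apply: closed_borel.
apply: (superlevel_closed (g := fun x : sphere R hd => dot x v)).
exact: dot_sphere_continuous.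
Qed.

(** Closeness is stated by two inequalities rather than by a distance, so that
    no subtraction of extended reals occurs and each inequality passes to the
    infimum. *)
Definition mass_close P Q (e : R) v : Prop :=
  (mass P (halfspace0 v) <= mass Q (halfspace0 v) + e%:E)%E /\
  (mass Q (halfspace0 v) <= mass P (halfspace0 v) + e%:E)%E.

(** Writing [g] for [<., u>], the halfspace of [v] lies between
    [superlevel g (c / 2)] and [superlevel g (- (c / 2))]. Weak convergence is
    applied between the levels [c / 2] and [c], and between [- c] and
    [- (c / 2)]; the strip pays for passing back to the halfspace of [v]. *)
Lemma mass_halfspace0_near (P_ : nat -> probability (borel (sphere R hd)) R)
    P u e :
  weak_cvg P_ P -> unit_sphere R d u ->
  mass P (boundary (halfspace0 u)) = 0%E -> 0 < e ->
  \forall v \near u & n \near \oo, mass_close (P_ n) P e v.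
Proof.
move=> wP Su; rewrite boundary_halfspace0// => P0 e0.
have e20 : 0 < e / 2 by rewrite divr_gt0.
pose g (x : sphere R hd) := dot x u.
have cg : continuous g by exact: dot_sphere_continuous.
have [c c0 Pc] := strip_small cg P0 e20.
have mS : measurable ([set x | `|g x| <= c] : set (borel (sphere R hd))).
  by apply: closed_borel; exact: strip_closed.
have mG a : measurable (superlevel g a : set (borel (sphere R hd))).
  by apply: closed_borel; exact: superlevel_closed.
have mH := @halfspace0_measurable.
have c20 : 0 < c / 2 by rewrite divr_gt0.
have cc : c / 2 < c by rewrite ltr_pdivrMr// ltr_pMr// ltr1n.
have ncc : - c < - (c / 2) by rewrite ltrN2.
have lo := weak_cvg_superlevel wP cg ncc e20.
have hi := weak_cvg_superlevel wP cg cc e20.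
exists ([set v | forall y, unit_sphere R d y -> `|dot y u - dot y v| <= c / 2],
  [set n |
    (P_ n (superlevel g (- (c / 2))) <=
       P (superlevel g (- c)) + (e / 2)%:E)%E /\
    (P (superlevel g c) <= P_ n (superlevel g (c / 2)) + (e / 2)%:E)%E]).
  split; first exact: dot_near.
  by apply: filterS (filterI lo hi) => n [[? _] [_ ?]]; split.
move=> [v n] /= [vu [h1 h2]].
have {}vu (x : sphere R hd) : `|g x - dot x v| <= c / 2.
  exact: vu (point_of_sphere x).
have eE : e%:E = ((e / 2)%:E + (e / 2)%:E)%E by rewrite -EFinD -splitr.
rewrite /mass_close eE !addeA /mass; split.
- apply: (@le_trans _ _ (P_ n (superlevel g (- (c / 2))))).
    apply: le_measure; rewrite ?inE// => x.
    rewrite /halfspace0 /superlevel /= => xv.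
    by have := vu x; rewrite ler_norml => /andP[]; lra.
  apply: (le_trans h1); rewrite leeD2r//.
  apply: (@le_trans _ _ (P ([set x | halfspace0 v (x : sphere R hd)] `|`
                            [set x | (`|g x| <= c)%R]))).
    apply: le_measure; rewrite ?inE//; first exact: measurableU.
    move=> x; rewrite /halfspace0 /superlevel /= => xc; have := vu x.
    rewrite ler_norml => /andP[v1 v2].
    by case: (leP (g x) c) => gc; [right; rewrite ler_norml; lra|left; lra].
  apply: (le_trans (measureU2 _ _ _)) => //.
  by rewrite leeD2l.
- apply: (@le_trans _ _ (P (superlevel g c `|` [set x | (`|g x| <= c)%R]))).
    apply: le_measure; rewrite ?inE//; first exact: measurableU.
    move=> x; rewrite /halfspace0 /superlevel /= => xv; have := vu x.
    rewrite ler_norml => /andP[v1 v2].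
    by case: (leP c (g x)) => gc; [left|right; rewrite ler_norml; lra].
  apply: (le_trans (measureU2 _ _ _)) => //.
  rewrite leeD//; apply: (le_trans h2); rewrite leeD2r//.
  apply: le_measure; rewrite ?inE// => x.
  rewrite /halfspace0 /superlevel /= => xv.
  by have := vu x; rewrite ler_norml => /andP[]; lra.
Qed.

(** Finitely many of the neighbourhoods of [mass_halfspace0_near] cover the
    compact set of directions; this is what [near_covering] encapsulates. *)
Lemma mass_halfspace0_uniform (P_ : nat -> probability (borel (sphere R hd)) R)
    P e :
  weak_cvg P_ P ->
  (forall H, central_halfspaces R hd H -> mass P (boundary H) = 0%E) ->
  0 < e ->
  \forall n \near \oo, forall u : sphere R hd, mass_close (P_ n) P e u.
Proof.
move=> wP bP e0.
have /compact_near_coveringP cover := @unit_sphere_compact R d.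
pose close n v := mass_close (P_ n) P e v.
suff near_close u : unit_sphere R d u ->
    \forall v \near u & n \near \oo, close n v.
  apply: filterS (cover nat \oo close _ near_close) => n h u.
  by apply: h; exact: point_of_sphere.
move=> Su; apply: mass_halfspace0_near => //; apply: bP.
by exists (exist _ u (mem_set Su)).
Qed.

Lemma ahD_fin_num P (x : sphere R hd) : ahD x P \is a fin_num.
Proof.
rewrite ge0_fin_numE; last first.
  by apply: le_ereal_inf_tmp => _ [u _ <-]; exact: measure_ge0.
(* [x] belongs to its own halfspace, so the infimum is over a nonempty set. *)
apply: (@le_lt_trans _ _ (mass P (halfspace0 x))).
  apply: ereal_inf_lbound; exists x => //.
  by rewrite /halfspace0 /= dot_sphere//; exact: point_of_sphere.
by rewrite (le_lt_trans (probability_le1 _ (halfspace0_measurable _)))// ltry.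
Qed.

Lemma le_ahD P Q (e : R) (x : sphere R hd) :
  (forall u : sphere R hd,
    (mass P (halfspace0 u) <= mass Q (halfspace0 u) + e%:E)%E) ->
  (ahD x P <= ahD x Q + e%:E)%E.
Proof.
move=> PQ; rewrite -leeBlDr//; apply: le_ereal_inf_tmp => _ [u xu <-].
rewrite leeBlDr//; apply: le_trans (PQ u).
by apply: ereal_inf_lbound; exists u.
Qed.

End spherical_depth.

Theorem theorem10 (R : realType) (d : nat) (hd : (2 <= d)%N)
    (P_ : nat -> probability (borel (sphere R hd)) R)
    (P : probability (borel (sphere R hd)) R)
    (hcvg : weak_cvg P_ P)
    (hbd : forall H : set 'rV[R]_d,
       central_halfspaces R hd H -> mass P (boundary H) = 0%E) :
  ereal_sup [set `|ahD x (P_ n) - ahD x P|%E | x in [set: sphere R hd]]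
    @[n --> \oo] --> 0%E.
Proof.
set s := fun n => ereal_sup _.
have s_ge0 n : (0 <= s n)%E.
  apply: le_trans (abse_ge0 (ahD point (P_ n) - ahD point P)) _.
  by apply: ereal_sup_ubound; exists point.
have s_le e : 0 < e -> \forall n \near \oo, (s n <= e%:E)%E.
  move=> e0; have := mass_halfspace0_uniform hcvg hbd e0.
  apply: filterS => n /= near_n; apply: ge_ereal_sup => _ [x _ <-].
  have h1 : (ahD x (P_ n) <= ahD x P + e%:E)%E.
    by apply: le_ahD => u; have [] := near_n u.
  have h2 : (ahD x P <= ahD x (P_ n) + e%:E)%E.
    by apply: le_ahD => u; have [] := near_n u.
  move: h1 h2.
  rewrite -(fineK (ahD_fin_num P x)) -(fineK (ahD_fin_num (P_ n) x)).
  by rewrite -!EFinD !lee_fin ler_distlC => h1 h2; apply/andP; split; lra.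
apply/fine_cvgP; split.
  apply: filterS (s_le _ ltr01) => n sn.
  by rewrite ge0_fin_numE// (le_lt_trans sn)// ltry.
apply/cvgrPdist_le => e e0; apply: filterS (s_le _ e0) => n sn /=.
rewrite sub0r normrN ger0_norm ?fine_ge0//.
by rewrite -lee_fin fineK// ge0_fin_numE// (le_lt_trans sn)// ltry.
Qed.
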